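(* Let $(f_n)$ be the Fibonacci sequence, i.e. $f_1=1$, $f_2=1$ and $f_n=f_{n-1}+f_{n-2}$ for all $n\ge 3$. Then the subgroup $t^s_{(f_n)}(\mathbb{T})$ of $\mathbb{T}$ is uncountable.
   Context: $\mathbb{T}=\mathbb{R}/\mathbb{Z}$ is the circle group, and for $x\in\mathbb{T}$, $\|x\|$ denotes the distance of (any representative of) $x$ to the nearest integer. For $A\subset\mathbb{N}$, the natural density is $d(A)=\lim_{n\to\infty}\frac{|A\cap[1,n]|}{n}$ when this limit exists. For a sequence of integers $(u_n)$, the statistically characterized subgroup is $$t^s_{(u_n)}(\mathbb{T})=\{x\in\mathbb{T}: \forall\varepsilon>0,\ d(\{n\in\mathbb{N}:\|u_nx\|\ge\varepsilon\})=0\}.$$ *)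

(* Defs.v *)
From HB Require Import structures.
From mathcomp Require Import all_boot all_order all_algebra.
From mathcomp Require Import all_classical all_reals all_analysis.

Set Implicit Arguments.
Unset Strict Implicit.
Unset Printing Implicit Defensive.

Import Order.TTheory GRing.Theory Num.Theory.
Import numFieldNormedType.Exports.

Local Open Scope classical_set_scope.
Local Open Scope quotient_scope.
Local Open Scope ring_scope.

(* [Num.int] is a qualifier, whereas quotients are taken by a structured
   predicate. *)
Definition int_pred (R : realType) : {pred R} := fun x => x \is a Num.int.

Lemma int_pred_zmod_closed (R : realType) : zmod_closed (@int_pred R).
Proof. by split=> [|x y]; [exact: rpred0 | exact: rpredB]. Qed.
HB.instance Definition _ (R : realType) :=
  GRing.isZmodClosed.Build R (@int_pred R) (@int_pred_zmod_closed R).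

(* The quotient group R/Z. Despite its name, [ideal_quot] accepts any additive
   subgroup, not only an ideal. *)
Definition circle (R : realType) : Type := {ideal_quot @int_pred R}.
HB.instance Definition _ (R : realType) :=
  EqQuotient.copy (circle R) {ideal_quot @int_pred R}.
HB.instance Definition _ (R : realType) :=
  GRing.Zmodule.copy (circle R) {ideal_quot @int_pred R}.
HB.instance Definition _ (R : realType) :=
  ZmodQuotient.copy (circle R) {ideal_quot @int_pred R}.

Definition dist_int (R : realType) (x : R) : R :=
  inf [set `|x - m%:~R| | m in [set: int]].

(* Does not depend on the representative: see [circle_normE]. *)
Definition circle_norm (R : realType) (x : circle R) : R := dist_int (repr x).

(* The density counts over [1, n], so whether 0 belongs to A is irrelevant. *)
Definition has_density (R : realType) (A : set nat) (l : R) : Prop :=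
  (fun n => (count (fun k => k \in A) (iota 1 n))%:R / n%:R : R) @ \oo --> l.

Definition stat_char_subgroup (R : realType) (u : nat -> int) :
    set (circle R) :=
  [set x | forall eps : R, 0 < eps ->
     has_density [set n | eps <= circle_norm (x *~ u n)] (0 : R)].
Arguments stat_char_subgroup : clear implicits.

Lemma dist_intDz (R : realType) (x : R) (k : int) :
  dist_int (x + k%:~R) = dist_int x.
Proof.
congr inf; apply/seteqP; split=> y [m _ <-].
  by exists (m - k) => //; rewrite rmorphB /= opprB addrA.
by exists (m + k) => //; rewrite rmorphD /= opprD addrACA subrr addr0.
Qed.

Lemma circle_normE (R : realType) (x : R) :
  circle_norm (\pi_(circle R) x) = dist_int x.
Proof.
rewrite /circle_norm.
have /intrP[k ek] : repr (\pi_(circle R) x) - x \is a Num.int.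
  by rewrite (Quotient.idealrBE (@int_pred R)) reprK.
by rewrite -[repr _](subrK x) ek addrC dist_intDz.
Qed.

Lemma has_inf_dist_int (R : realType) (x : R) :
  has_inf [set `|x - m%:~R| | m in [set: int]].
Proof.
split; first by exists `|x - 0%:~R|, 0.
by exists 0 => _ [m _ <-].
Qed.

Lemma dist_int_le (R : realType) (x : R) (m : int) :
  dist_int x <= `|x - m%:~R|.
Proof.
have := ge_inf (has_inf_dist_int x).2.
by move=> /(_ `|x - m%:~R|); apply; exists m.
Qed.

Lemma dist_intB (R : realType) (x y : R) :
  dist_int (x - y) <= dist_int x + dist_int y.
Proof.
apply/ler_addgt0Pr => e e0.
have e20 : 0 < e / 2 by rewrite divr_gt0.
have [_ [m _ <-] hm] := inf_adherent e20 (has_inf_dist_int x).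
have [_ [k _ <-] hk] := inf_adherent e20 (has_inf_dist_int y).
apply: (@le_trans _ _ `|(x - y) - (m - k)%:~R|).
  exact: dist_int_le.
have -> : x - y - (m - k)%:~R = (x - m%:~R) - (y - k%:~R).
  by rewrite rmorphB /= !opprB [k%:~R - m%:~R]addrC addrACA [k%:~R - y]addrC.
rewrite (le_trans (ler_normB _ _))// [leRHS](_ : _ =
  (dist_int x + e / 2) + (dist_int y + e / 2)).
  by rewrite lerD// ltW.
by rewrite addrACA -splitr.
Qed.

Lemma dist_int0 (R : realType) : dist_int (0 : R) = 0.
Proof.
apply/eqP; rewrite eq_le; apply/andP; split.
  by rewrite (le_trans (dist_int_le 0 0))// subr0 normr0.
by apply: lb_le_inf (has_inf_dist_int 0).1 _ => _ [m _ <-].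
Qed.

Lemma circle_normB (R : realType) (x y : circle R) :
  circle_norm (x - y) <= circle_norm x + circle_norm y.
Proof.
rewrite -[x]reprK -[y]reprK -[X in circle_norm X](pi_is_zmod_morphism) /=.
by rewrite !circle_normE dist_intB.
Qed.

Lemma circle_norm0 (R : realType) : circle_norm (0 : circle R) = 0.
Proof.
have -> : (0 : circle R) = \pi_(circle R) 0 by rewrite pi_zeror.
by rewrite circle_normE dist_int0.
Qed.

Lemma has_density0_sub (R : realType) (A B C : set nat) :
  A `<=` B `|` C -> has_density B (0 : R) -> has_density C (0 : R) ->
  has_density A (0 : R).
Proof.
move=> sABC dB dC; have := cvgD dB dC; rewrite addr0 => /(_ _) dBC.
have d0 : (fun=> 0 : R) @ \oo --> (0 : R) by exact: cvg_cst.
apply: (squeeze_cvgr _ d0 dBC); apply: nearW => n.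
rewrite divr_ge0//=.
rewrite [leRHS](_ : _ = (count (fun k => k \in B) (iota 1 n))%:R / n%:R +
  (count (fun k => k \in C) (iota 1 n))%:R / n%:R)//.
rewrite -mulrDl ler_wpM2r ?invr_ge0// -natrD ler_nat -count_predUI.
apply: leq_trans (leq_addr _ _); apply: sub_count => k /=.
by rewrite !inE => /sABC [] h; apply/orP; [left|right]; rewrite inE.
Qed.

Lemma stat_char_subgroup_zmod_closed (R : realType) (u : nat -> int) :
  zmod_closed [pred x | x \in stat_char_subgroup R u].
Proof.
split; first apply: mem_set => e e0.
  rewrite (_ : [set _ | _] = set0).
    apply: cvg_near_cst; apply: nearW => n.
    by rewrite (eq_count (a2 := pred0)) ?count_pred0 ?mul0r// => k; rewrite in_set0.
  by apply/seteqP; split=> n //=; rewrite mul0rz circle_norm0 leNgt e0.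
move=> x y /set_mem dx /set_mem dy; apply: mem_set => e e0.
have e20 : 0 < e / 2 by rewrite divr_gt0.
apply: has_density0_sub (dx _ e20) (dy _ e20) => n /=; rewrite mulrzBl => le_e.
case: (leP (e / 2) (circle_norm (x *~ u n))) => [|ltx]; first by left.
right; rewrite leNgt; apply/negP => lty.
have := le_lt_trans (circle_normB _ _) (ltrD ltx lty).
by rewrite -splitr ltNge le_e.
Qed.

(* Main.v *)
(* Let [a] be the inverse of the golden ratio. Since [f_n a - f_(n-1)] is, up to
   sign, a power of [a], the distance from [f_n a^m] to the nearest integer is at
   most [a^|n - m|]. For a 0-1 sequence [s] put [x_s = \sum_j s_j a^((j+2)^2)]; by
   lacunarity distinct sequences give distinct points of [0, 1). Summing the bound
   over [n <= N], each square up to about [N] contributes O(1), so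
   [\sum_(n <= N) ||f_n x_s||] is O(sqrt N), and by Markov's inequality the [n]
   with [||f_n x_s|| >= eps] have density 0. *)
Require Import Defs.
From mathcomp Require Import all_boot all_order all_algebra.
From mathcomp Require Import all_classical all_reals all_analysis.
From mathcomp Require Import zify ring lra.

Import Order.TTheory GRing.Theory Num.Theory.
Import numFieldNormedType.Exports.

Local Open Scope classical_set_scope.
Local Open Scope ring_scope.

(** * Fibonacci numbers, diagonal argument, integer square roots *)

Fixpoint fib (n : nat) : nat :=
  match n with
  | 0 => 0
  | n1.+1 => match n1 with 0 => 1 | n2.+1 => fib n1 + fib n2 end
  end.

Lemma fibSS n : fib n.+2 = (fib n.+1 + fib n)%N.
Proof. by []. Qed.

Lemma fib_unique (f : nat -> int) (f1 : f 1%N = 1) (f2 : f 2%N = 1)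
    (fS : forall n : nat, (3 <= n)%N -> f n = f (n - 1)%N + f (n - 2)%N) n :
  f n.+1 = fib n.+1.
Proof.
suff: f n.+1 = fib n.+1 /\ f n.+2 = fib n.+2 by case.
elim: n => [|n [IH1 IH2]]; first by rewrite f1 f2.
split=> //.
by rewrite fS // subn1 subn2 /= IH1 IH2 -PoszD.
Qed.

(** Cantor's diagonal: if [g] numbered [S], the sequence [d] would disagree with itself at its own
    index [g (h d)]. *)
Lemma uncountable_of_cantor_inj {T : Type} (S : set T) (h : (nat -> bool) -> T) :
  injective h -> (forall s, S (h s)) -> ~ countable S.
Proof.
move=> h_inj hS /countable_injP[g g_inj].
pose d n := `[< exists s, g (h s) = n /\ s n = false >].
have key s : g (h s) = g (h d) -> s = d.
  by move=> /g_inj e; apply/h_inj/e; exact/mem_set/hS.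
case E: (d (g (h d))).
  move: (E) => /asboolP[s [/key -> ]]; by rewrite E.
by move: (E) => /asboolP[]; exists d.
Qed.

Lemma exists_sqrtn N : exists J, (J ^ 2 <= N < J.+1 ^ 2)%N.
Proof.
elim: N => [|N [J /andP[J1 J2]]]; first by exists 0%N.
case: (ltnP N.+1 (J.+1 ^ 2)) => h.
  by exists J; rewrite h (leqW J1).
by exists J.+1; rewrite h /=; nia.
Qed.

(** * Fibonacci multiples of powers of the inverse golden ratio *)

Section GoldenRatio.
Variables (R : realType) (a : R).
Hypotheses (a_gt0 : 0 < a) (a_sqr : a ^+ 2 = 1 - a).

Let a_ge0 : 0 <= a := ltW a_gt0.

Lemma golden_ge : 1 / 2 <= a.
Proof. by move: a_gt0 a_sqr; nra. Qed.

Lemma golden_le : a <= 2 / 3.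
Proof. by move: a_gt0 a_sqr; nra. Qed.

Lemma golden_le1 : a <= 1.
Proof. by move: golden_le; lra. Qed.

(** By [a_sqr], passing from [n] to [n.+1] multiplies the left side by [- a]. *)
Lemma fibS_mul_golden n : (fib n.+1)%:R * a - (fib n)%:R = a * (- a) ^+ n.
Proof.
elim: n => [|n IH]; first by rewrite /= expr0; ring.
rewrite fibSS natrD exprS mulrCA -IH.
apply/eqP; rewrite -subr_eq0.
have -> : ((fib n.+1)%:R + (fib n)%:R) * a - (fib n.+1)%:R
    - - a * ((fib n.+1)%:R * a - (fib n)%:R)
    = (fib n.+1)%:R * (a ^+ 2 - (1 - a)) by ring.
by rewrite a_sqr subrr mulr0.
Qed.

(* Both truncated differences together give the distance |n - m|. *)
Lemma fib_mul_golden_pow n m :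
  `|(fib n)%:R * a ^+ m - (fib (n - m))%:R| <= a ^+ ((n - m) + (m - n)).
Proof.
elim: m => [|m IH].
  by rewrite subn0 expr0 mulr1 subrr normr0 exprn_ge0.
case: (leqP n m) => [nm|mn].
  have e1 : (n - m = 0)%N by lia.
  have e2 : (n - m.+1 = 0)%N by lia.
  have e3 : (m.+1 - n = (m - n).+1)%N by lia.
  move: IH; rewrite e1 e2 e3 /= !subr0 !add0n => IH.
  by rewrite !exprS mulrCA normrM (ger0_norm a_ge0) ler_wpM2l.
set k := (n - m.+1)%N.
have e1 : (n - m = k.+1)%N by rewrite /k; lia.
have e2 : (m - n = 0)%N by lia.
have e3 : (m.+1 - n = 0)%N by lia.
move: IH; rewrite e1 e2 e3 !addn0 => IH.
(* The induction hypothesis times [a] contributes [a ^+ k.+2], and replacing [fib k.+1 * a] by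
   [fib k] costs [a ^+ k.+1]. Since [a ^+ 2 + a = 1], these add up to exactly [a ^+ k]. *)
have -> : (fib n)%:R * a ^+ m.+1 - (fib k)%:R =
    a * ((fib n)%:R * a ^+ m - (fib k.+1)%:R)
    + ((fib k.+1)%:R * a - (fib k)%:R) by rewrite exprS; ring.
apply: le_trans (ler_normD _ _) _.
rewrite fibS_mul_golden !normrM normrX normrN ger0_norm //.
apply: le_trans (lerD (ler_wpM2l a_ge0 IH) (lexx _)) _.
rewrite exprS mulrA -mulrDl -expr2 a_sqr.
by rewrite -[leRHS]mul1r ler_wpM2r ?exprn_ge0 // subrK.
Qed.

(** Two geometric series: as [a <= 2 / 3], the indices below [m] give at most a/(1-a) <= 2, the
    others at most 1/(1-a) <= 3. Both inductions reduce to [3 * a <= 2]. *)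
Lemma sum_golden_dist m N :
  \sum_(n < N) a ^+ ((n - m) + (m - n)) <= 5.
Proof.
have a_le := golden_le.
have before k : (k <= m)%N ->
    \sum_(n < k) a ^+ ((n - m) + (m - n)) <= 2 * a ^+ (m - k).
  elim: k => [|k IH] km; first by rewrite big_ord0 mulr_ge0 // exprn_ge0.
  rewrite big_ord_recr /=.
  have -> : (k - m + (m - k) = (m - k.+1).+1)%N by lia.
  have := IH (ltnW km); have -> : (m - k = (m - k.+1).+1)%N by lia.
  have := exprn_ge0 (m - k.+1) a_ge0; rewrite exprS.
  by move: (a ^+ _) (\sum_(_ < _) _) => u v; nra.
have after k : \sum_(n < m + k) a ^+ ((n - m) + (m - n)) <= 5 - 3 * a ^+ k.
  elim: k => [|k IH].
    rewrite addn0 expr0; have := before m (leqnn m); rewrite subnn expr0.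
    by move: (\sum_(_ < _) _) => u; lra.
  rewrite addnS big_ord_recr /=.
  have -> : (m + k - m + (m - (m + k)) = k)%N by lia.
  have := exprn_ge0 k a_ge0; rewrite exprS.
  by move: IH; move: (a ^+ _) (\sum_(_ < _) _) => u v; nra.
case: (leqP N m) => [Nm|/ltnW mN].
  apply: le_trans (before _ Nm) _.
  by have := exprn_ile1 (m - N) a_ge0 golden_le1; lra.
rewrite -(subnKC mN); apply: le_trans (after _) _.
by have := exprn_ge0 (N - m) a_ge0; lra.
Qed.

(** * The lacunary points and their injectivity *)

Implicit Types s : nat -> bool.

(** The shift by 2 makes the first exponent 4, so that the bound [2 * a ^+ 4 <= 1 / 2] keeps the
    points in [0, 1). *)
Definition lacunary_sum s J : R := \sum_(j < J) (s j)%:R * a ^+ ((j + 2) ^ 2).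

(** The supremum is the sum of the series, whose terms are nonnegative. *)
Definition lacunary_point s : R := sup (range (lacunary_sum s)).

Lemma lacunary_sumS s J :
  lacunary_sum s J.+1 = lacunary_sum s J + (s J)%:R * a ^+ ((J + 2) ^ 2).
Proof. by rewrite /lacunary_sum big_ord_recr. Qed.

Lemma lacunary_sum_homo s : {homo lacunary_sum s : J K / (J <= K)%N >-> J <= K}.
Proof.
apply: homo_leq => [//|y x z|J]; first exact: le_trans.
by rewrite lacunary_sumS lerDl mulr_ge0 ?ler0n ?exprn_ge0.
Qed.

(** The exponents differ by 2J + 5 >= 4, and [4 * a ^+ 4 = 4 * (1 - a) ^+ 2 <= 1] because
    [1 / 2 <= a]. A factor above 2 is what makes [lacunary_point_lt] strict. *)
Lemma golden_pow_gap J : 4 * a ^+ ((J.+1 + 2) ^ 2) <= a ^+ ((J + 2) ^ 2).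
Proof.
have -> : ((J.+1 + 2) ^ 2 = (J + 2) ^ 2 + 4 + (J.*2).+1)%N
    by rewrite -!mulnn; lia.
rewrite !exprD; have := exprn_ge0 ((J + 2) ^ 2) a_ge0.
have := exprn_ile1 (J.*2).+1 a_ge0 golden_le1.
have := exprn_ge0 (J.*2).+1 a_ge0.
have h4 : 4 * a ^+ 4 <= 1.
  rewrite (exprM a 2 2) a_sqr; move: golden_ge golden_le; nra.
have := exprn_ge0 4 a_ge0.
move: h4; move: (a ^+ 4) (a ^+ (J.*2).+1) (a ^+ ((J + 2) ^ 2)) => u v w.
move=> h u0 v0 v1 w0.
rewrite -mulrA mulrCA -[leRHS]mulr1 ler_wpM2l //.
by rewrite mulrA; apply: mulr_ile1 => //; rewrite mulr_ge0.
Qed.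

(** The right side is nonincreasing in [K]: a new term is paid for by the drop of the doubled
    power. *)
Lemma lacunary_sum_ub s J K :
  lacunary_sum s J <= lacunary_sum s K + 2 * a ^+ ((K + 2) ^ 2).
Proof.
have ubK i : lacunary_sum s (K + i) + 2 * a ^+ ((K + i + 2) ^ 2)
    <= lacunary_sum s K + 2 * a ^+ ((K + 2) ^ 2).
  elim: i => [|i]; first by rewrite addn0.
  apply: le_trans; rewrite addnS lacunary_sumS.
  have := golden_pow_gap (K + i); have := exprn_ge0 ((K + i + 2) ^ 2) a_ge0.
  by case: (s _) => /=; lra.
apply: le_trans (lacunary_sum_homo s J (K + J) (leq_addl _ _)) _.
by apply: le_trans (ubK J); rewrite lerDl mulr_ge0 // exprn_ge0.
Qed.

Lemma lacunary_point_le s J :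
  lacunary_point s <= lacunary_sum s J + 2 * a ^+ ((J + 2) ^ 2).
Proof.
apply: ge_sup; first by exists (lacunary_sum s 0), 0%N.
by move=> _ [K _ <-]; exact: lacunary_sum_ub.
Qed.

Lemma lacunary_point_ge s J : lacunary_sum s J <= lacunary_point s.
Proof.
apply: ub_le_sup; last by exists J.
exists (lacunary_sum s 0 + 2 * a ^+ ((0 + 2) ^ 2)) => _ [K _ <-].
exact: lacunary_sum_ub.
Qed.

Lemma lacunary_point_itv s : 0 <= lacunary_point s < 1.
Proof.
have := lacunary_point_ge s 0; have := lacunary_point_le s 0.
rewrite /lacunary_sum big_ord0 add0r (exprM a 2 2) a_sqr.
by move: golden_ge golden_le => ? ? ? ->/=; nra.
Qed.

(** The tail of [t] after [j] is at most [2 * a ^+ ((j.+1 + 2) ^ 2)], half of the term that [s]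
    gains at [j]. *)
Lemma lacunary_point_lt s t j : (forall i, (i < j)%N -> s i = t i) ->
  s j = true -> t j = false -> lacunary_point t < lacunary_point s.
Proof.
move=> st sj tj.
have := lacunary_point_ge s j.+1; have := lacunary_point_le t j.+1.
rewrite !lacunary_sumS sj tj /=.
have -> : lacunary_sum t j = lacunary_sum s j.
  by apply: eq_bigr => i _; rewrite st.
by have := golden_pow_gap j; have := exprn_gt0 ((j + 2) ^ 2) a_gt0; lra.
Qed.

Lemma lacunary_point_inj : injective lacunary_point.
Proof.
move=> s t st; apply/funext => k; apply/eqP/negPn/negP => nk.
have ex : exists k, s k != t k by exists k.
case: (ex_minnP ex) => j nj jmin.
have sub i : (i < j)%N -> s i = t i.
  by move=> ij; apply/eqP/negPn/negP => /jmin; rewrite leqNgt ij.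
case sj: (s j) nj; case tj: (t j) => // _.
  by have := lacunary_point_lt s t j sub sj tj; rewrite st ltxx.
have := lacunary_point_lt t s j (fun i ij => esym (sub i ij)) tj sj.
by rewrite st ltxx.
Qed.

Lemma pi_lacunary_point_inj :
  injective (fun s => \pi_(circle R)%qT (lacunary_point s)).
Proof.
move=> s t st; apply: lacunary_point_inj.
have /intrP[k ek] : lacunary_point s - lacunary_point t \is a Num.int.
  by rewrite (Quotient.idealrBE (@int_pred R)) st.
have /andP[s0 s1] := lacunary_point_itv s.
have /andP[t0 t1] := lacunary_point_itv t.
suff k0 : k = 0 by apply/eqP; rewrite -subr_eq0 ek k0.
have : (k%:~R : R) < 1%:~R by rewrite -ek; lra.
have : (-1)%:~R < (k%:~R : R) by rewrite -ek; lra.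
by rewrite !ltr_int; lia.
Qed.

(** * Distances of Fibonacci multiples of a lacunary point *)

Lemma dist_int_fib_lacunary s n J : (n <= (J + 2) ^ 2)%N ->
  dist_int ((fib n)%:R * lacunary_point s) <=
    \sum_(j < J) a ^+ ((n - (j + 2) ^ 2) + ((j + 2) ^ 2 - n))
    + 2 * a ^+ ((n - (J + 2) ^ 2) + ((J + 2) ^ 2 - n)).
Proof.
move=> nJ.
(* [M] sums the integers that [fib_mul_golden_pow] assigns to the terms; truncated subtraction gives
   [fib 0 = 0] once the exponent reaches [n]. *)
pose M := (\sum_(j < J) s j * fib (n - (j + 2) ^ 2))%N.
apply: le_trans (dist_int_le _ M) _.
set x := lacunary_point s; set y := lacunary_sum s J.
have -> : (fib n)%:R * x - M%:~R
    = ((fib n)%:R * y - M%:R) + (fib n)%:R * (x - y) by rewrite pmulrn; ring.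
apply: le_trans (ler_normD _ _) _; apply: lerD.
  rewrite /y /lacunary_sum /M natr_sum mulr_sumr -sumrB.
  apply: le_trans (ler_norm_sum _ _ _) _; apply: ler_sum => j _.
  rewrite natrM mulrCA -mulrBr normrM normr_nat.
  apply: le_trans (fib_mul_golden_pow _ _).
  by rewrite -[leRHS]mul1r ler_wpM2r // lern1 leq_b1.
have y_le : y <= x := lacunary_point_ge s J.
rewrite normrM normr_nat ger0_norm ?subr_ge0 //.
(* As [n <= (J + 2) ^ 2], the approximating integer is 0, so this bounds the product itself and
   hence the tail. *)
have := fib_mul_golden_pow n ((J + 2) ^ 2).
have -> : (n - (J + 2) ^ 2 = 0)%N by lia.
rewrite add0n subr0 ger0_norm ?mulr_ge0 ?exprn_ge0 // => h.
have x_le : x - y <= 2 * a ^+ ((J + 2) ^ 2).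
  by rewrite lerBlDl; exact: lacunary_point_le.
apply: le_trans (ler_wpM2l (ler0n _ _) x_le) _.
by rewrite mulrCA ler_wpM2l.
Qed.

(** With one [J] for all [n], exchanging the sums leaves [J] sums of at most 5 and the doubled tail
    sum, at most 10. *)
Lemma sum_dist_int_fib_lacunary s N J : (N <= (J + 2) ^ 2)%N ->
  \sum_(n < N.+1) dist_int ((fib n)%:R * lacunary_point s) <= 5 * J%:R + 10.
Proof.
move=> NJ.
apply: (@le_trans _ _ (\sum_(n < N.+1)
   (\sum_(j < J) a ^+ ((n - (j + 2) ^ 2) + ((j + 2) ^ 2 - n))
    + 2 * a ^+ ((n - (J + 2) ^ 2) + ((J + 2) ^ 2 - n))))).
  apply: ler_sum => n _; apply: dist_int_fib_lacunary.
  by apply: leq_trans NJ; rewrite -ltnS.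
rewrite big_split /= -mulr_sumr exchange_big /=; apply: lerD.
  apply: (@le_trans _ _ (\sum_(j < J) 5)).
    by apply: ler_sum => j _; exact: sum_golden_dist.
  by rewrite sumr_const card_ord mulr_natr.
by have := sum_golden_dist ((J + 2) ^ 2) N.+1; lra.
Qed.

End GoldenRatio.

(** * From sums of distances to density zero *)

Lemma markov_count {R : realType} (g : nat -> R) (eps : R) (s : seq nat) :
  (forall n, 0 <= g n) ->
  (count (fun n => eps <= g n) s)%:R * eps <= \sum_(n <- s) g n.
Proof.
move=> g0; elim: s => [|n s IH]; first by rewrite big_nil mul0r.
rewrite big_cons /= natrD mulrDl; apply: lerD => //.
by case: (leP eps (g n)) => h /=; rewrite ?mul1r ?mul0r ?g0.
Qed.

(** Here J is the integer square root of N, so J/N is at most the square root of 1/N. *)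
Lemma has_density0_sqrt {R : realType} (A : set nat) (C D : R) :
  0 <= C ->
  (forall N J, (J ^ 2 <= N < J.+1 ^ 2)%N ->
     (count (fun k => k \in A) (iota 1 N))%:R <= C * J%:R + D) ->
  has_density A (0 : R).
Proof.
move=> C0 cA.
have inv0 : (fun n => (n%:R : R)^-1) @ \oo --> (0 : R).
  apply/gtr0_cvgV0; last exact: cvgr_idn.
  by exists 1%N => // n /= n0; rewrite ltr0n.
have sqrt0 : (fun n => Num.sqrt (n%:R : R)^-1) @ \oo --> (0 : R).
  rewrite -[X in _ --> X]sqrtr0.
  by apply: (cvg_comp _ _ inv0); exact: sqrt_continuous.
have ub0 : (fun n => C * Num.sqrt (n%:R : R)^-1 + D * n%:R^-1) @ \oo --> (0 : R).
  rewrite [X in _ --> X](_ : 0 = C * 0 + D * 0); last by rewrite !mulr0 addr0.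
  by apply: cvgD; (apply: cvgM; first exact: cvg_cst).
apply: (squeeze_cvgr _ (cvg_cst (0 : R)) ub0); apply: nearW => N.
rewrite divr_ge0 //=.
have [J JN] := exists_sqrtn N.
apply: (@le_trans _ _ ((C * J%:R + D) / N%:R)).
  by rewrite ler_wpM2r ?invr_ge0 // cA.
rewrite mulrDl lerD2r -mulrA ler_wpM2l //.
(* For [N = 0] both sides vanish, the inverse of 0 being 0. *)
have [->|N0] := posnP N; first by rewrite invr0 mulr0 sqrtr0.
rewrite ler_pdivrMr ?ltr0n // -ler_sqr ?nnegrE ?mulr_ge0 ?sqrtr_ge0 //.
rewrite exprMn sqr_sqrtr ?invr_ge0 // (expr2 N%:R) mulKf ?pnatr_eq0 -?lt0n //.
by rewrite -natrX ler_nat; case/andP: JN.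
Qed.

Lemma dist_int_ge0 {R : realType} (x : R) : 0 <= dist_int x.
Proof. by apply: lb_le_inf (has_inf_dist_int x).1 _ => _ [m _ <-]. Qed.

Lemma circle_norm_pi_mulrz {R : realType} (x : R) (k : int) :
  circle_norm (\pi_(circle R)%qT x *~ k) = dist_int (k%:~R * x).
Proof.
suff -> : \pi_(circle R)%qT x *~ k = \pi_(circle R)%qT (x *~ k).
  by rewrite circle_normE mulrzl.
by rewrite (raddfMz (\pi_(circle R)%qT)).
Qed.

Theorem corollary2p5 (R : realType) (f : nat -> int)
  (f1 : f 1%N = 1) (f2 : f 2%N = 1)
  (fS : forall n : nat, (3 <= n)%N -> f n = f (n - 1)%N + f (n - 2)%N) :
  ~ countable (stat_char_subgroup R f).
Proof.
pose a : R := (Num.sqrt 5 - 1) / 2.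
have sq5 : Num.sqrt 5 ^+ 2 = 5 :> R by rewrite sqr_sqrtr.
have sq5_ge0 : 0 <= Num.sqrt 5 :> R by exact: sqrtr_ge0.
have a_gt0 : 0 < a by rewrite /a; nra.
have a_sqr : a ^+ 2 = 1 - a.
  by rewrite /a; move: sq5; move: (Num.sqrt 5) => r h; field: h.
apply: (uncountable_of_cantor_inj _ _ (pi_lacunary_point_inj R a a_gt0 a_sqr)).
move=> s eps eps0.
(* The bound [5 * J%:R + 10] on the sum, divided by [eps] as in Markov's inequality. *)
apply: (has_density0_sqrt _ (5 / eps) (10 / eps)).
  by rewrite divr_ge0 // ltW.
move=> N J /andP[_ NJ].
rewrite mulrAC -mulrDl ler_pdivlMr //.
set x := lacunary_point R a s.
have -> : count (fun k => k \in [set n | eps <= circle_norm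
      (\pi_(circle R)%qT x *~ f n)]) (iota 1 N)
    = count (fun n => eps <= dist_int ((fib n)%:R * x)) (iota 1 N).
  (* The value [f 0] is arbitrary, but the count starts at 1, where [f] and [fib] agree. *)
  apply: eq_in_count => -[|n]; rewrite mem_iota // => _.
  by apply/idP/idP; rewrite inE /= circle_norm_pi_mulrz
    (fib_unique _ f1 f2 fS) pmulrn.
apply: le_trans (markov_count _ _ _ (fun n => dist_int_ge0 _)) _.
apply: le_trans (sum_dist_int_fib_lacunary R a a_gt0 a_sqr s N J _); last by nia.
rewrite -(big_mkord xpredT (fun n => dist_int ((fib n)%:R * x))) /index_iota.
by rewrite subn0 /= big_cons lerDr dist_int_ge0.
Qed.
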